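(* Let $\mathbf{K}$ be a field of characteristic zero, let $n\ge 1$ and let $d$ be a nonnegative integer. Let $F=X+H:\mathbf{K}^n\to\mathbf{K}^n$ be a polynomial map, where $X=(x_1,\dots,x_n)^t$ is the identity map and every component of $H=(H_1,\dots,H_n)^t\in\mathbf{K}[x_1,\dots,x_n]^n$ is either zero or a homogeneous polynomial of degree $d$. If $\det JF=1$, then $F$ is injective on the lines that pass through the origin, i.e. for every one-dimensional linear subspace $L\subseteq\mathbf{K}^n$, the restriction of $F$ to $L$ is injective.
   Context: For a polynomial map $F=(F_1,\dots,F_n)^t$ with $F_i\in\mathbf{K}[x_1,\dots,x_n]$, $JF=(\partial F_i/\partial x_j)_{1\le i,j\le n}$ denotes its Jacobian matrix, with entries in $\mathbf{K}[x_1,\dots,x_n]$. The condition $\det JF=1$ is an equality of polynomials. *)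

(* Defs.v *)
From HB Require Import structures.
From mathcomp Require Export all_boot all_order all_algebra.
From mathcomp Require Export mpoly.

Set Implicit Arguments.
Unset Strict Implicit.
Unset Printing Implicit Defensive.

Import GRing.Theory.
Local Open Scope ring_scope.

Definition idpolymap (K : fieldType) (n : nat) : 'cV[{mpoly K[n]}]_n :=
  \col_(i < n) 'X_i.

Definition jacobian (K : fieldType) (n : nat) (F : 'cV[{mpoly K[n]}]_n) :
  'M[{mpoly K[n]}]_n :=
  \matrix_(i < n, j < n) (F i 0)^`M(j).

Definition polymap_eval (K : fieldType) (n : nat) (F : 'cV[{mpoly K[n]}]_n)
  (x : 'cV[K]_n) : 'cV[K]_n :=
  \col_(i < n) (F i 0).@[fun j => x j 0].

(* Main.v *)
(* Restricted to a line K v, the map is F(T v) = T v + T^d H(v). If F(s v) = F(t v)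
   with s <> t, then H(v) = mu v, so F(T v) = q(T) v with q = T + mu T^d. By the
   chain rule JF(T v) v = q'(T) v; since det JF(T v) = 1 this makes q' a unit of
   K[T], so in characteristic zero q is affine with nonzero slope, hence
   injective. *)
From HB Require Import structures.
Require Import Defs.
Import GRing.Theory.
Local Open Scope ring_scope.

(** Chain rule. Both sides are additive in [p] and obey the Leibniz rule, so it suffices to check
    variables; products then give monomials, and induction on the terms gives all polynomials. *)
Lemma deriv_mmap (R : comNzRingType) (n : nat) (h : 'I_n -> {poly R})
    (p : {mpoly R[n]}) :
  (mmap polyC h p)^`() = \sum_j mmap polyC h p^`M(j) * (h j)^`().
Proof.
pose P (q : {mpoly R[n]}) :=
  (mmap polyC h q)^`() = \sum_j mmap polyC h q^`M(j) * (h j)^`().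
have PM q r : P q -> P r -> P (q * r).
  rewrite /P => Pq Pr; rewrite rmorphM derivM Pq Pr mulr_suml mulr_sumr.
  rewrite -big_split /=; apply: eq_bigr => j _.
  by rewrite mderivM rmorphD !rmorphM mulrDl mulrAC mulrA.
have P1 : P 1.
  rewrite /P rmorph1 derivC big1 // => j _.
  by rewrite -mpolyC1 mderivC rmorph0 mul0r.
have PX i : P 'X_i.
  rewrite /P mmapX mmap1U (bigD1 i) //= big1 => [|j ji].
    rewrite mderivX mnm1E eqxx scale1r -{1}[U_(i)%MM]add0m addmK mpolyX0 rmorph1 mul1r addr0 //.
  by rewrite mderivX mnm1E eq_sym (negbTE ji) scale0r rmorph0 mul0r.
rewrite -/(P p); elim/mpolyind: p => [|c m p _ _ Pp]; rewrite /P.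
  rewrite rmorph0 deriv0 big1 // => j _.
  by rewrite mderiv0 rmorph0 mul0r.
have Pm : P 'X_[m].
  rewrite mpolyXE_id; elim/big_ind: _ => //= i _.
  by elim: (m i) => [|k IHk]; rewrite ?expr0 // exprS; apply: PM.
rewrite rmorphD /= derivD Pp mmapZ derivM derivC mul0r add0r Pm mulr_sumr.
rewrite -big_split /=; apply: eq_bigr => j _.
by rewrite mderivD mderivZ rmorphD /= mmapZ mulrDl mulrA.
Qed.

(** The parameter of the line stays formal, so that restrictions can be differentiated and tested
    for divisibility; being a ring morphism, it commutes with determinants. *)
Definition line_subst {R : comNzRingType} {n : nat} (v : 'cV[R]_n) :
    {mpoly R[n]} -> {poly R} :=
  mmap polyC (fun i => v i 0 *: 'X).

HB.instance Definition _ (R : comNzRingType) (n : nat) (v : 'cV[R]_n) :=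
  GRing.RMorphism.on (line_subst v).

Lemma horner_line_subst {R : comNzRingType} {n : nat} (v : 'cV[R]_n) (s : R)
    (p : {mpoly R[n]}) :
  (line_subst v p).[s] = p.@[fun j => (s *: v) j 0].
Proof.
rewrite mevalE /line_subst /mmap horner_sum; apply: eq_bigr => m _.
rewrite hornerM hornerC /mmap1 horner_prod; congr (_ * _).
by apply: eq_bigr => i _; rewrite horner_exp hornerZ hornerX mxE mulrC.
Qed.

Lemma line_subst_homog {R : comNzRingType} {n : nat} (v : 'cV[R]_n) {d : nat}
    {p : {mpoly R[n]}} :
  p \is d.-homog -> line_subst v p = p.@[fun j => v j 0] *: 'X^d.
Proof.
move=> /dhomogP hp; rewrite mevalE /line_subst /mmap scaler_suml.
apply: eq_big_seq => m /hp <-; rewrite mul_polyC -scalerA; congr (_ *: _).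
rewrite /mmap1 /= mdegE -prodrXr -scaler_prod.
by apply: eq_bigr => i _; rewrite exprZn.
Qed.

(** This is [deriv_mmap] along a line, where the inner derivatives are the constants [v j 0]. *)
Lemma line_subst_jacobian {R : comNzRingType} {n : nat} (v : 'cV[R]_n)
    (F : 'cV[{mpoly R[n]}]_n) :
  map_mx (line_subst v) (\matrix_(i, j) (F i 0)^`M(j)) *m map_mx polyC v =
  map_mx (fun p => (line_subst v p)^`()) F.
Proof.
apply/colP => i; rewrite !mxE deriv_mmap; apply: eq_bigr => j _.
by rewrite !mxE derivZ derivX alg_polyC.
Qed.

Lemma horner_inj_deriv_const {K : fieldType} {q : {poly K}} :
  [pchar K] =i pred0 -> size q^`() = 1%N -> injective (horner q).
Proof.
move=> /pcharf0P K0 szq'.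
have szq : (size q <= 2)%N.
  apply/leq_sizeP => -[|[|k]] // _; apply/eqP.
  (* Coefficient [k.+1] of the derivative is [k.+2] times coefficient [k.+2] of [q], and [k.+2] is
     nonzero in [K]. *)
  have /eqP : q^`()`_k.+1 = 0 by apply: nth_default; rewrite szq'.
  by rewrite coef_deriv -mulr_natr mulf_eq0 K0 orbF.
have q1 : q`_1 != 0.
  have : q^`() != 0 by rewrite -size_poly_eq0 szq'.
  by rewrite -lead_coef_eq0 lead_coefE szq' coef_deriv mulr1n.
move=> s t; rewrite !(horner_coef_wide _ szq) !big_ord_recl !big_ord0 /=.
by move=> /addrI; rewrite !addr0 !expr1 => /(mulfI q1).
Qed.

Theorem theorem1 (K : fieldType) (n d : nat) (F H : 'cV[{mpoly K[n]}]_n) :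
  [pchar K] =i pred0 ->
  (0 < n)%N ->
  F = idpolymap K n + H ->
  (forall i : 'I_n, H i 0 = 0 \/ H i 0 \is d.-homog) ->
  \det (jacobian F) = 1 ->
  forall L : {vspace 'cV[K]_n}, \dim L = 1%N ->
    {in L &, injective (polymap_eval F)}.
Proof.
move=> K0 _ FE Hd detF L dimL x y xL yL Fxy.
have [v v0 LE] : exists2 v : 'cV[K]_n, v != 0 & L = <[v]>%VS.
  have v0 : vpick L != 0 by rewrite vpick0 -dimv_eq0 dimL.
  exists (vpick L) => //; apply/esym/eqP.
  by rewrite eqEdim -memvE memv_pick dim_vline v0 dimL.
move: xL yL Fxy; rewrite LE => /vlineP[s ->] /vlineP[t ->] Fst.
have [->//|st] := eqVneq s t.
pose h i := (H i 0).@[fun j => v j 0].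
have lineF i : line_subst v (F i 0) = v i 0 *: 'X + h i *: 'X^d.
  rewrite FE !mxE rmorphD /= /line_subst mmapX mmap1U; congr (_ + _).
  have [Hi0|] := Hd i; first by rewrite /h Hi0 rmorph0 meval0 scale0r.
  exact: line_subst_homog.
have horF i : (line_subst v (F i 0)).[s] = (line_subst v (F i 0)).[t].
  by rewrite !horner_line_subst; have /colP/(_ i) := Fst; rewrite !mxE.
have hst i : (s ^+ d - t ^+ d) * h i = (t - s) * v i 0.
  have := horF i; rewrite lineF !hornerE => E.
  apply/eqP; rewrite !mulrBl subr_eq addrAC eq_sym subr_eq.
  by rewrite [eqbRHS]addrC ![_ * v i 0]mulrC ![_ * h i]mulrC E.
have [i vi0] : exists i, v i 0 != 0.
  by have /cV0Pn := v0.
(* Otherwise [hst] at the nonzero coordinate [i] would force [s = t]; this also excludes [d = 0]. *)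
have std : s ^+ d - t ^+ d != 0.
  apply: contraNneq st => std0.
  have /esym/eqP := hst i; rewrite std0 mul0r mulf_eq0 (negbTE vi0) orbF.
  by rewrite subr_eq0 eq_sym.
(* The ratio in [hst] does not depend on the coordinate, hence a single factor [mu] serves all of
   them. *)
pose mu := (t - s) / (s ^+ d - t ^+ d).
have hE j : h j = mu * v j 0.
  by apply: (mulfI std); rewrite hst /mu mulrA mulrCA divff // mulr1.
pose q : {poly K} := 'X + mu *: 'X^d.
have lineFq j : line_subst v (F j 0) = v j 0 *: q.
  by rewrite lineF hE scalerDr scalerA mulrC.
pose M := map_mx (line_subst v) (jacobian F).
have detM : \det M = 1 by rewrite det_map_mx detF rmorph1.
(* So [v] is an eigenvector of [M], with eigenvalue the derivative of [q]. *)
have Mv : M *m map_mx polyC v = q^`() *: map_mx polyC v.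
  rewrite /M line_subst_jacobian; apply/colP => j.
  by rewrite !mxE lineFq derivZ mulrC mul_polyC.
have : q^`() %| 1.
  rewrite -(dvdpZr _ _ vi0) alg_polyC.
  have : map_mx polyC v = q^`() *: (\adj M *m map_mx polyC v).
    by rewrite scalemxAr -Mv mulmxA mul_adj_mx detM mul1mx.
  by move=> /colP/(_ i); rewrite !mxE => ->; apply: dvdp_mulr.
rewrite dvdp1 => /eqP/(horner_inj_deriv_const K0) qinj.
(* Coordinate [i] of the assumed equality reads [v i 0 * q.[s] = v i 0 * q.[t]]. *)
congr (_ *: _); apply: qinj; apply: (mulfI vi0).
by rewrite -!hornerZ -lineFq horF.
Qed.
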